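(* Let $U\neq\emptyset$ be a set and let $F,G\colon U\to\mathbb{R}\cup\{+\infty\}$ be functions such that $F+G\not\equiv+\infty$. For $\alpha\in[0,+\infty)$ let $H_\alpha\colon U\to\mathbb{R}\cup\{+\infty\}$, $H_\alpha(u):=F(u)+\alpha G(u)$. Then for all but at most countably many $\alpha\in[0,+\infty)$ the following holds: if $\inf_{u\in U}H_\alpha(u)>-\infty$, then there exists some $G_\alpha\in[-\infty,+\infty]$ such that $G(u_i)\to G_\alpha$ as $i\to\infty$ for every minimizing sequence $(u_i)_{i\in\mathbb{N}}$ of $H_\alpha$.
   Context: A minimizing sequence of $H_\alpha$ is a sequence $(u_i)_{i\in\mathbb{N}}$ in $U$ with $\lim_{i\to\infty}H_\alpha(u_i)=\inf_{u\in U}H_\alpha(u)$. No structure on $U$ is assumed. Convergence of $G(u_i)$ is in $[-\infty,+\infty]$. Convention: $0\cdot(+\infty)=0$, i.e. $H_0=F$. *)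

(* Defs.v *)
From HB Require Import structures.
From mathcomp Require Import all_boot all_order all_algebra.
From mathcomp Require Import all_classical all_reals all_analysis.

Set Implicit Arguments.
Unset Strict Implicit.
Unset Printing Implicit Defensive.

Import Order.TTheory GRing.Theory Num.Theory.
Import numFieldNormedType.Exports.

Local Open Scope classical_set_scope.
Local Open Scope ring_scope.
Local Open Scope ereal_scope.

(* Extended-real multiplication satisfies 0 * +oo = 0 (mul0e), so that
   Hfun F G 0 = F even where G is infinite. *)
Definition Hfun (R : realType) (U : Type) (F G : U -> \bar R) (alpha : R) :
  U -> \bar R := fun u => F u + alpha%:E * G u.

Definition minimizing_sequence (R : realType) (U : Type) (H : U -> \bar R)
    (u_ : nat -> U) : Prop :=
  H (u_ i) @[i --> \oo] --> ereal_inf (range H).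

(* Main.v *)
Require Import Defs.
From HB Require Import structures.
From mathcomp Require Import all_boot all_order all_algebra.
From mathcomp Require Import all_classical all_reals all_analysis.
From mathcomp Require Import lra.

(** Write m(alpha) for the infimum of H_alpha.  If alpha is exceptional, there
    are rationals r < s such that m(alpha) is approached both on {G <= r} and
    on {s <= G}.  Testing H_beta on points of {G <= r} that almost minimize
    H_alpha shows that the slope of m from alpha to any beta > alpha is at most
    r; symmetrically, the slope of m from any alpha < beta to beta is at least
    s if m(beta) is approached on {s <= G}.  Hence two exceptional parameters
    cannot share the pair (r, s), and there are only countably many pairs. *)

Set Implicit Arguments.
Unset Strict Implicit.
Unset Printing Implicit Defensive.

Import Order.TTheory GRing.Theory Num.Theory.
Import numFieldNormedType.Exports.

Local Open Scope classical_set_scope.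
Local Open Scope ring_scope.
Local Open Scope ereal_scope.

Lemma countable_is_subset1 (T : Type) (A : set T) :
  is_subset1 A -> countable A.
Proof.
move=> A1; have [[x Ax]|/set0P/negP] := pselect (A !=set0).
  suff -> : A = [set x] by [].
  by apply/seteqP; split=> [y Ay|_ ->//]; exact: A1.
by rewrite negbK => /eqP ->.
Qed.

(** A basic neighbourhood of [l] is an interval whose ends are open or infinite. An infinite end
    imposes no condition, so limits at [-oo] and [+oo] need no separate treatment. *)
Lemma order_cvg (d : Order.disp_t) (T : orderTopologicalType d) (I : Type)
    (E : set_system I) (FE : Filter E) (f : I -> T) (l : T) :
  (forall y, (y < l)%O -> \forall i \near E, (y < f i)%O) ->
  (forall y, (l < y)%O -> \forall i \near E, (f i < y)%O) ->
  f i @[i --> E] --> l.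
Proof.
move=> lo hi A; rewrite /= itv_nbhsE => -[[a b] [ends lab] abA].
apply: (filterS (P := [set i | f i \in Interval a b])).
  by move=> i fi; apply: abA.
move: lab; rewrite itv_boundlr => /andP[la lb].
have {la}lo' : \forall i \near E, (a <= BLeft (f i))%O.
  case: a ends la {abA} => [c a /itv_open_ends_lside -> |c].
    by rewrite bnd_simp => /lo; apply: filterS => i; rewrite bnd_simp.
  by move=> /itv_open_ends_linfty -> _; apply: filterE.
have {lb}hi' : \forall i \near E, (BRight (f i) <= b)%O.
  case: b ends lb {abA} => [c b /itv_open_ends_rside -> |c].
    by rewrite bnd_simp => /hi; apply: filterS => i; rewrite bnd_simp.
  by move=> /itv_open_ends_rinfty -> _; apply: filterE.
by apply: filterS2 lo' hi' => i; rewrite /= itv_boundlr => -> ->.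
Qed.

Lemma lte_rat_between (R : realType) (x y : \bar R) : x < y ->
  exists r s : rat,
    [/\ (ratr r < ratr s :> R)%R, x <= (ratr r)%:E & (ratr s)%:E <= y].
Proof.
move=> xy.
have [a [b [ab xa yb]]] :
    exists a b : R, [/\ (a < b)%R, x <= a%:E & b%:E <= y].
  case: x y xy => [x||] [y||] //; rewrite ?lte_fin => xy.
  - by exists x, y.
  - by exists x, (x + 1)%R; rewrite ltrDl ltr01 lexx leey.
  - by exists (y - 1)%R, y; rewrite gtrDl ltrN10 lexx leNye.
  - by exists 0%R, 1%R; rewrite ltr01 leNye leey.
have [r] := rat_in_itvoo ab; rewrite in_itv /= => /andP[ar rb].
have [s] := rat_in_itvoo rb; rewrite in_itv /= => /andP[rs sb].
by exists r, s; split=> //; [rewrite (le_trans xa) // lee_fin ltW |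
  rewrite (le_trans _ yb) // lee_fin ltW].
Qed.

(** The reverse inequality always holds, so this says that the two infima agree; neither has to be
    attained. *)
Definition inf_approached_on (R : realType) (U : Type) (H : U -> \bar R)
  (A : set U) := ereal_inf (H @` A) <= ereal_inf (range H).

Section infimum.
Variables (R : realType) (U : Type).

Lemma inf_approached_onS (H : U -> \bar R) (A B : set U) : A `<=` B ->
  inf_approached_on H A -> inf_approached_on H B.
Proof. by move=> AB; apply: le_trans; apply/ereal_inf_le_tmp/image_subset. Qed.

(** The infimum over [A] is strictly above the limit of [H (u_ i)], so the open ray below it
    eventually contains these values. *)
Lemma minimizing_sequence_avoids (H : U -> \bar R) (A : set U) (u_ : nat -> U) :
  ~ inf_approached_on H A -> minimizing_sequence H u_ ->
  \forall i \near \oo, ~ A (u_ i).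
Proof.
move=> /negP; rewrite -ltNge => HA Hu.
have nbhs_inf : nbhs (ereal_inf (range H)) [set y | y < ereal_inf (H @` A)].
  by apply: open_nbhs_nbhs; split=> //; exact: open_ereal_lt_ereal.
have : \forall i \near \oo, H (u_ i) < ereal_inf (H @` A) := Hu _ nbhs_inf.
apply: filterS => i + Au; rewrite ltNge => /negP; apply.
by apply: ereal_inf_lbound; exists (u_ i).
Qed.

(* The limit is the infimum of the levels [p] for which [H] approaches its
   infimum on [G <= p]. *)
Lemma minimizing_levels (H G : U -> \bar R) :
  ~ (exists l : \bar R, forall u_, minimizing_sequence H u_ ->
       G (u_ i) @[i --> \oo] --> l) ->
  exists r s : rat, [/\ (ratr r < ratr s :> R)%R,
    inf_approached_on H [set u | G u <= (ratr r)%:E] &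
    inf_approached_on H [set u | (ratr s)%:E <= G u]].
Proof.
apply: contra_notP => nogap.
pose P := [set p | inf_approached_on H [set u | G u <= p]].
exists (ereal_inf P) => u_ Hu; apply: order_cvg => y.
  move=> yP.
  have nPy : ~ P y by move=> /ereal_inf_lbound; rewrite leNgt yP.
  have := minimizing_sequence_avoids nPy Hu.
  by apply: filterS => i /= /negP; rewrite -ltNge.
(* Some level [p < y] lies in [P]. If the infimum were also approached on [y <= G], two rationals
   between [p] and [y] would form a pair excluded by [nogap]. *)
move=> /ereal_inf_lt[p Pp] /lte_rat_between[r [s [rs pr sy]]].
have nQy : ~ inf_approached_on H [set u | y <= G u].
  move=> Qy; apply: nogap; exists r, s; split=> //.
    by apply: inf_approached_onS Pp => u /= /le_trans; apply.
  by apply: inf_approached_onS Qy => u /=; apply: le_trans.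
have := minimizing_sequence_avoids nQy Hu.
by apply: filterS => i /= /negP; rewrite -ltNge.
Qed.

Variables F G : U -> \bar R.
Hypotheses (hF : forall u, F u <> -oo) (hG : forall u, G u <> -oo).

Local Notation m alpha := (ereal_inf (range (Hfun F G alpha))).

(** Pointwise, H_beta = H_alpha + (beta - alpha) G wherever [F] and [G] are finite. The slope bound
    is written without a quotient because the infima may be infinite. *)
Lemma Hfun_inf_slope_le (alpha beta p : R) : (alpha < beta)%R ->
  inf_approached_on (Hfun F G alpha) [set u | G u <= p%:E] ->
  m beta <= m alpha + ((beta - alpha) * p)%:E.
Proof.
move=> ab; rewrite -leeBlDr //; apply: le_trans.
apply: le_ereal_inf_tmp => _ [u Gp <-]; rewrite leeBlDr //.
apply: le_trans (ereal_inf_lbound (imageP _ I) : _ <= Hfun F G beta u) _.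
rewrite /Hfun; move: (@hF u) (@hG u) (Gp : _ <= _).
case: (F u) => [f||] // _; case: (G u) => [g||] // _=> /= gp.
by move: gp; rewrite -!EFinM -!EFinD !lee_fin; nra.
Qed.

Lemma Hfun_inf_slope_ge (alpha beta q : R) :
  (0 <= alpha)%R -> (alpha < beta)%R ->
  inf_approached_on (Hfun F G beta) [set u | q%:E <= G u] ->
  m alpha <= m beta + ((alpha - beta) * q)%:E.
Proof.
move=> a0 ab; rewrite -leeBlDr //; apply: le_trans.
apply: le_ereal_inf_tmp => _ [u Gq <-]; rewrite leeBlDr //.
apply: le_trans (ereal_inf_lbound (imageP _ I) : _ <= Hfun F G alpha u) _.
(* Here [G u] may be [+oo]; as [beta] is positive, H_beta is then [+oo] at [u] and the bound is
   trivial, even for [alpha = 0]. *)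
have b0 := le_lt_trans a0 ab.
rewrite /Hfun; move: (@hF u) (@hG u) (Gq : _ <= _).
case: (F u) => [f||] // _; case: (G u) => [g||] // _ => gq.
- by move: gq; rewrite -!EFinM -!EFinD !lee_fin; nra.
- by rewrite (gt0_muley (x := beta%:E)) ?lte_fin // leey.
- by rewrite (gt0_muley (x := beta%:E)) ?lte_fin // leey.
Qed.

Lemma exceptional_pair_unique (alpha beta r s : R) :
  (0 <= alpha)%R -> (alpha < beta)%R -> (r < s)%R ->
  m alpha \is a fin_num -> m beta \is a fin_num ->
  inf_approached_on (Hfun F G alpha) [set u | G u <= r%:E] ->
  inf_approached_on (Hfun F G beta) [set u | s%:E <= G u] -> False.
Proof.
move=> a0 ab rs fa fb /(Hfun_inf_slope_le ab) + /(Hfun_inf_slope_ge a0 ab).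
(* Adding the two bounds and cancelling the finite infima leaves (beta - alpha) (s - r) <= 0. *)
by rewrite -(fineK fa) -(fineK fb) -!EFinD !lee_fin; nra.
Qed.

(** At a point where [F + G] is not [+oo] both functions are finite, and this one point bounds the
    infimum from above for every [alpha]. *)
Lemma Hfun_inf_fin_num (alpha : R) : ~ (forall u, F u + G u = +oo) ->
  -oo < m alpha -> m alpha \is a fin_num.
Proof.
move=> /existsNP[u FGu] mNy; rewrite fin_numElt mNy /=.
apply: le_lt_trans (ereal_inf_lbound (imageP _ I) : _ <= Hfun F G alpha u) _.
rewrite /Hfun; move: (@hF u) (@hG u) FGu.
case: (F u) => [f||] //; case: (G u) => [g||] // _ _ _.
by rewrite -EFinM -EFinD ltry.
Qed.

End infimum.

Theorem theorem1p2 (R : realType) (U : Type) (F G : U -> \bar R)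
    (hU : [set: U] !=set0)
    (hF : forall u : U, F u <> -oo) (hG : forall u : U, G u <> -oo)
    (hFG : ~ (forall u : U, F u + G u = +oo)) :
  countable [set alpha : R | (0 <= alpha)%R /\
    ~ (-oo < ereal_inf (range (Hfun F G alpha)) ->
       exists Galpha : \bar R, forall u_ : nat -> U,
         minimizing_sequence (Hfun F G alpha) u_ ->
         G (u_ i) @[i --> \oo] --> Galpha)].
Proof.
pose E (rs : rat * rat) := [set alpha : R | [/\ (0 <= alpha)%R,
  (ratr rs.1 < ratr rs.2 :> R)%R,
  ereal_inf (range (Hfun F G alpha)) \is a fin_num,
  inf_approached_on (Hfun F G alpha) [set u | G u <= (ratr rs.1)%:E] &
  inf_approached_on (Hfun F G alpha) [set u | (ratr rs.2)%:E <= G u]]].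
apply: (@sub_countable _ _ _ (\bigcup_rs E rs)).
  apply: subset_card_le => alpha [a0 /not_implyP[mNy /minimizing_levels]].
  move=> [r [s [rs Pr Qs]]]; exists (r, s) => //; split=> //.
  exact: Hfun_inf_fin_num hFG mNy.
apply: bigcup_countable => // -[r s] _; apply: countable_is_subset1.
move=> alpha beta [/= a0 rs fa Pa Qa] [/= b0 _ fb Pb Qb].
(* Both parameters satisfy both approach conditions, so whichever is smaller supplies the bound with
   [r] and the larger one the bound with [s]. *)
have [ab|ba|//] := ltgtP alpha beta.
  by case: (exceptional_pair_unique hF hG a0 ab rs fa fb Pa Qb).
by case: (exceptional_pair_unique hF hG b0 ba rs fb fa Pb Qa).
Qed.
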